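(* For every non-negative integer $n$, \[ \sum_{k=0}^n (-1)^k 2^{n-k} L_{k+1} = (-1)^{n} F_{n+1}, \] where $(F_m)_{m\ge 0}$ are the Fibonacci numbers and $(L_m)_{m\ge 0}$ are the Lucas numbers.
   Context: The Fibonacci numbers are defined by $F_0=0$, $F_1=1$, $F_{m+2}=F_{m+1}+F_m$ for $m\ge 0$. The Lucas numbers are defined by $L_0=2$, $L_1=1$, $L_{m+2}=L_{m+1}+L_m$ for $m\ge 0$. *)

(* Defs.v *)
From mathcomp Require Import all_boot.

Fixpoint fib (n : nat) : nat :=
  match n with
  | 0 => 0
  | 1 => 1
  | (m.+1 as p).+1 => fib p + fib m
  end.

Fixpoint lucas (n : nat) : nat :=
  match n with
  | 0 => 2
  | 1 => 1
  | (m.+1 as p).+1 => lucas p + lucas m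
  end.

(* Main.v *)
(** Writing S_n for the sum, S_(n+1) = 2 S_n + (-1)^(n+1) L_(n+2); since
    L_(n+2) = F_(n+2) + 2 F_(n+1), the term 2 S_n cancels by induction. *)
Require Import Defs.
From mathcomp Require Import all_boot all_order all_algebra.
From mathcomp Require Import zify ring.
Import GRing.Theory.
Local Open Scope ring_scope.

(** Induction on $n$: the new alternating term, split by [lucasS_fib], cancels twice the old sum and
    leaves only the next signed Fibonacci number. *)

Lemma fibSS (n : nat) : fib n.+2 = (fib n.+1 + fib n)%N.
Proof. by []. Qed.

Lemma lucasSS (n : nat) : lucas n.+2 = (lucas n.+1 + lucas n)%N.
Proof. by []. Qed.

Lemma lucasS_fib (n : nat) : lucas n.+1 = (fib n.+1 + 2 * fib n)%N.
Proof.
(* The recurrences have order two, so the induction carries two consecutive indices. *)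
suff [] : lucas n.+1 = (fib n.+1 + 2 * fib n)%N /\
          lucas n.+2 = (fib n.+2 + 2 * fib n.+1)%N by [].
elim: n => [//|n [IH1 IH2]]; split=> //.
by rewrite lucasSS IH1 IH2 (fibSS n.+1) (fibSS n); lia.
Qed.

Theorem theorem1 (n : nat) :
  \sum_(0 <= k < n.+1) (-1) ^+ k * 2 ^+ (n - k)%N * (lucas k.+1)%:Z
  = (-1) ^+ n * (fib n.+1)%:Z.
Proof.
elim: n => [|n IH]; first by rewrite big_nat1.
rewrite big_nat_recr //= subnn.
(* Since $k \le n$, the truncated difference satisfies $n+1-k = (n-k)+1$, so a factor 2 comes out of
   each old term. *)
have -> : \sum_(0 <= k < n.+1) (-1) ^+ k * 2 ^+ (n.+1 - k)%N * (lucas k.+1)%:Z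
          = 2 * ((-1) ^+ n * (fib n.+1)%:Z).
  rewrite -IH big_distrr /=; apply: eq_big_nat => k /andP[_ ltkn].
  by rewrite subSn // exprS; ring.
rewrite -lucasSS -fibSS lucasS_fib PoszD PoszM exprS; ring.
Qed.
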